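(* Let $I$ be a complete ideal of $S=K[t_1,\ldots,t_s]$ minimally generated by monomials $t^{v_1},\ldots,t^{v_q}$ of degree $d$ and let $\alpha(\overline{I^n})$ be the initial degree of $\overline{I^n}$. Then $$\lim_{n\rightarrow\infty}\frac{\alpha(\overline{I^n})}{n}=|v_q|.$$
   Context: $S$ is a polynomial ring over a field $K$; $t^a=t_1^{a_1}\cdots t_s^{a_s}$ for $a=(a_1,\ldots,a_s)\in\mathbb{N}^s$, $\mathbb{N}=\{0,1,\ldots\}$, and $|a|=\sum_{i=1}^sa_i$ (so $|v_q|=d$); $q\geq 1$. $\overline{L}$ is the integral closure of an ideal $L$, and a monomial ideal $I$ is complete if $I=\overline{I}$. The initial degree $\alpha(L)$ of a monomial ideal $L$ is the least degree of a minimal generator of $L$. *)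

(* Defs.v *)
From HB Require Import structures.
From mathcomp Require Export all_boot all_order all_algebra.
(* mpoly has to be imported before the analysis libraries: in the other order
   their notations make its import fail. *)
From mathcomp Require Export mpoly.
From mathcomp Require Export boolp classical_sets.
From mathcomp Require Export reals topology normedtype sequences.
Export numFieldNormedType.Exports.

Set Implicit Arguments.
Unset Strict Implicit.
Unset Printing Implicit Defensive.

Import GRing.Theory.

Local Open Scope classical_set_scope.
Local Open Scope ring_scope.

Definition ideal_gen (A : comNzRingType) (G : set A) : set A :=
  [set x | exists (n : nat) (c g : 'I_n -> A),
     (forall i, G (g i)) /\ x = \sum_(i < n) c i * g i].

(* The empty product is 1, so [ideal_exp I 0] is the unit ideal. *)
Definition ideal_exp (A : comNzRingType) (I : set A) (n : nat) : set A :=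
  ideal_gen [set y | exists x : 'I_n -> A,
     (forall i, I (x i)) /\ y = \prod_(i < n) x i].

(* x is integral over I when
   x^m + a_1 x^(m-1) + ... + a_m = 0 with m >= 1 and a_k in I^k. *)
Definition integral_closure (A : comNzRingType) (I : set A) : set A :=
  [set x | exists (m : nat) (a : nat -> A),
     [/\ (0 < m)%N,
         forall k, (1 <= k <= m)%N -> ideal_exp I k (a k)
       & x ^+ m + \sum_(1 <= k < m.+1) a k * x ^+ (m - k) = 0]].

Definition complete_ideal (A : comNzRingType) (I : set A) : Prop :=
  I = integral_closure I.

Section MonomialIdeals.
Variables (K : fieldType) (s : nat).

(* Sets of monomials t^a are represented by the sets of their exponents a. *)
Definition monomial_ideal_gen (M : set 'X_{1..s}) : set {mpoly K[s]} :=
  ideal_gen [set 'X_[K, a] | a in M].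

Definition minimal_monomial_generators
    (L : set {mpoly K[s]}) (M : set 'X_{1..s}) : Prop :=
  L = monomial_ideal_gen M /\
  forall M' : set 'X_{1..s},
    M' `<=` M -> L = monomial_ideal_gen M' -> M' = M.

(* A monomial ideal has exactly one minimal set of monomial generators;
   t^a is a minimal generator when it belongs to that set. *)
Definition minimal_generator (L : set {mpoly K[s]}) (a : 'X_{1..s}) : Prop :=
  exists M, minimal_monomial_generators L M /\ M a.

(* The default value 0 is taken only when L has no minimal generator, i.e.
   when L is zero or is not a monomial ideal. *)
Definition initial_degree (L : set {mpoly K[s]}) : nat :=
  xget 0%N [set k | (exists a, minimal_generator L a /\ mdeg a = k) /\
                    (forall b, minimal_generator L b -> (k <= mdeg b)%N)].

End MonomialIdeals.

(* Main.v *)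
From HB Require Import structures.
From mathcomp Require Import zify.
Require Import Defs.

Set Implicit Arguments.
Unset Strict Implicit.
Unset Printing Implicit Defensive.

Import Order.TTheory GRing.Theory Num.Theory.

Local Open Scope classical_set_scope.
Local Open Scope ring_scope.

(** The limit is that of an eventually constant sequence: the initial degree of
the integral closure of I^n is exactly n d. A monomial t^a is integral over a
monomial ideal J as soon as t^(k a) lies in J^k for some k >= 1. If J is
generated in degree e, then so is J^k in degree k e, and comparing degrees
gives k e <= k |a|, that is e <= |a|; the generators of J reach this bound. For
J = I^n we have e = n d.

The real content is that the integral closure of a finitely generated monomial
ideal J is again a monomial ideal, spanned by the monomials t^a just described
([integral_closure_monomial]); without this, minimal monomial generators and
the initial degree would make no sense for it. Two facts are needed.

- The integral closure is closed under addition ([integral_closureD]). An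
  element x is integral over J exactly when x T is integral over the Rees
  algebra, the subring of A[T] whose elements have their coefficient of T^i in
  J^i ([integral_closureP]), and elements integral over a subring can be added.

- If f is integral over J, then so is each of its terms
  ([integral_closure_support]). Take c <> 0 in a high power of J; the integral
  equation gives c f^n in J^n for all n ([integral_almost]). Leading monomials
  are multiplicative, so c0 + n b dominates a sum of n generator exponents of J
  for every n, where c0 and b are the leading exponents of c and f. Dickson's
  lemma produces n < n' such that this decomposition grows in every entry from
  n to n'; subtracting one from the other, (n' - n) b dominates a sum of n' - n
  generator exponents, i.e. t^((n' - n) b) lies in J^(n' - n)
  ([lead_power_of_almost_integral]). Hence the leading term of f is integral,
  it can be subtracted from f, and induction on the number of terms ends the
  argument. Dickson's lemma replaces here the usual separation of b from the
  Newton polyhedron of J by a linear form. *)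

(** * Ideals and their powers *)

Section Ideals.
Variable A : comNzRingType.
Implicit Types (G I : set A) (x y c : A).

Lemma ideal_gen_sub G x : G x -> ideal_gen G x.
Proof.
move=> Gx; exists 1%N, (fun=> 1), (fun=> x); split=> //.
by rewrite big_ord1 mul1r.
Qed.

Lemma ideal_gen0 G : ideal_gen G 0.
Proof.
by exists 0%N, (fun=> 0), (fun=> 0); split=> [[]//|]; rewrite big_ord0.
Qed.

Lemma ideal_genM G c x : ideal_gen G x -> ideal_gen G (c * x).
Proof.
case=> n [a [g [Gg ->]]]; exists n, (fun i => c * a i), g; split=> //.
by rewrite mulr_sumr; apply: eq_bigr => i _; rewrite mulrA.
Qed.

Lemma ideal_genD G x y : ideal_gen G x -> ideal_gen G y -> ideal_gen G (x + y).
Proof.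
case=> n [a [g [Gg ->]]] [m [b [h [Gh ->]]]].
pose glue (u : 'I_n -> A) (v : 'I_m -> A) i :=
  match split i with inl j => u j | inr j => v j end.
exists (n + m)%N, (glue a b), (glue g h); split.
  by move=> i; rewrite /glue; case: split.
rewrite big_split_ord; congr (_ + _); apply: eq_bigr => i _; rewrite /glue.
  by case: split_ordP => j /eqP; rewrite ?eq_lshift ?eq_lrshift // => /eqP->.
by case: split_ordP => j /eqP; rewrite ?eq_rshift ?eq_rlshift // => /eqP->.
Qed.

Lemma ideal_genN G x : ideal_gen G x -> ideal_gen G (- x).
Proof. by rewrite -mulN1r; apply: ideal_genM. Qed.

Lemma ideal_gen_sum G (J : Type) (r : seq J) (P : pred J) (F : J -> A) :
  (forall j, P j -> ideal_gen G (F j)) -> ideal_gen G (\sum_(j <- r | P j) F j).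
Proof.
by move=> GF; apply: big_ind => //; [apply: ideal_gen0 | apply: ideal_genD].
Qed.

Lemma ideal_gen_min G (P : A -> Prop) :
  P 0 -> (forall x y, P x -> P y -> P (x + y)) ->
  (forall c x, G x -> P (c * x)) -> forall x, ideal_gen G x -> P x.
Proof.
by move=> P0 PD PG x [n [c [g [Gg ->]]]]; apply: big_ind => // i _; apply: PG.
Qed.

Lemma ideal_exp0 I x : ideal_exp I 0 x.
Proof.
rewrite -[x]mulr1; apply: ideal_genM; apply: ideal_gen_sub.
by exists (fun=> 0); split=> [[]//|]; rewrite big_ord0.
Qed.

Lemma ideal_exp1 I x : I x -> ideal_exp I 1 x.
Proof.
by move=> Ix; apply: ideal_gen_sub; exists (fun=> x); split; rewrite ?big_ord1.
Qed.

Lemma ideal_expM I m n x y :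
  ideal_exp I m x -> ideal_exp I n y -> ideal_exp I (m + n) (x * y).
Proof.
move=> Ix Iy; move: x Ix; apply: ideal_gen_min => [|x x' Ix Ix'|c x [u [Iu ->]]].
- by rewrite mul0r; apply: ideal_gen0.
- by rewrite mulrDl; apply: ideal_genD.
move: y Iy; apply: ideal_gen_min => [|y y' Iy Iy'|c' y [v [Iv ->]]].
- by rewrite mulr0; apply: ideal_gen0.
- by rewrite mulrDr; apply: ideal_genD.
rewrite mulrACA; apply/ideal_genM/ideal_gen_sub.
exists (fun i => match split i with inl j => u j | inr j => v j end); split.
  by move=> i; case: split.
rewrite big_split_ord; congr (_ * _); apply: eq_bigr => i _.
  by case: split_ordP => j /eqP; rewrite ?eq_lshift ?eq_lrshift // => /eqP->.
by case: split_ordP => j /eqP; rewrite ?eq_rshift ?eq_rlshift // => /eqP->.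
Qed.

Lemma ideal_expX I n x : I x -> ideal_exp I n (x ^+ n).
Proof.
move=> Ix; apply: ideal_gen_sub; exists (fun=> x); split=> //.
by rewrite prodr_const card_ord.
Qed.

Lemma ideal_exp_prodX I (T : finType) (x : T -> A) (c : T -> nat) :
  (forall t, I (x t)) -> ideal_exp I (\sum_t c t) (\prod_t x t ^+ c t).
Proof.
move=> Ix; apply: (big_ind2 (fun n y => ideal_exp I n y)) => [|n y m z|t _].
- exact: ideal_exp0.
- exact: ideal_expM.
- exact: ideal_expX.
Qed.

Lemma ideal_expW I m n x : (n <= m)%N -> ideal_exp I m x -> ideal_exp I n x.
Proof.
move=> le_nm; rewrite -(subnK le_nm); move: x.
apply: ideal_gen_min => [||c x [u [Iu ->]]].
- exact: ideal_gen0.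
- exact: ideal_genD.
rewrite big_split_ord mulrA; apply/ideal_genM/ideal_gen_sub.
by exists (fun i => u (rshift (m - n) i)).
Qed.

(** * Integral closure *)

Lemma integral_of_power I k x :
  (0 < k)%N -> ideal_exp I k (x ^+ k) -> integral_closure I x.
Proof.
move=> k_gt0 Ixk; exists k, (fun i => if i == k then - x ^+ k else 0); split=> //.
  by move=> i _; case: eqP => [->|_]; [apply: ideal_genN | apply: ideal_gen0].
rewrite big_nat_recr //= eqxx subnn mulr1 big_nat_cond big1 ?add0r ?subrr //.
by move=> i /andP[/andP[_ /ltn_eqF->] _]; rewrite mul0r.
Qed.

(** A uniform denominator for all powers of an integral element: rewriting x^m
by the integral equation of degree m trades a factor x^k for a factor in I^k,
and below exponent m the multiplier already lies in a large enough power of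
I. *)
Lemma integral_almost I x : integral_closure I x ->
  exists m, forall c, ideal_exp I m c -> forall n, ideal_exp I n (c * x ^+ n).
Proof.
case=> m [a [m_gt0 Ia /eqP]]; rewrite addr_eq0 => /eqP xm.
exists m => c Ic; elim/ltn_ind=> n IHn.
have [lt_nm|le_mn] := ltnP n m.
  by rewrite mulrC; apply/ideal_genM/(ideal_expW (ltnW lt_nm)).
rewrite -(subnKC le_mn) exprD xm mulNr mulrN; apply: ideal_genN.
rewrite mulr_suml mulr_sumr big_nat_cond; apply: ideal_gen_sum => k.
rewrite andbT ltnS => /[dup] k_bnd /andP[k_gt0 le_km].
have -> : c * (a k * x ^+ (m - k) * x ^+ (n - m)) = a k * (c * x ^+ (n - k)).
  rewrite -mulrA -exprD addnC addnBA // subnK //.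
  by rewrite mulrCA.
rewrite subnKC // -(subnKC (leq_trans le_km le_mn)).
apply: ideal_expM; first exact: Ia.
by rewrite subnKC ?(leq_trans le_km) //; apply: IHn;
  rewrite ltn_subrL k_gt0 (leq_trans m_gt0).
Qed.

End Ideals.

(** * The Rees algebra and sums of integral elements *)

Section Rees.
Variables (A : comNzRingType) (I : set A).

(** The Rees algebra of I: it turns integrality over an ideal into integrality
over a subring, for which sums are already understood. *)
Definition rees : pred {poly A} := fun p => `[< forall i, ideal_exp I i p`_i >].

Lemma rees_subring_closed : subring_closed rees.
Proof.
split=> [|p q|p q].
- apply/asboolP => i; rewrite coef1.
  by case: i => [|i]; [apply: ideal_exp0 | apply: ideal_gen0].
- move=> /asboolP Ip /asboolP Iq; apply/asboolP => i; rewrite coefB.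
  by apply: ideal_genD; [apply: Ip | apply: ideal_genN; apply: Iq].
move=> /asboolP Ip /asboolP Iq; apply/asboolP => i; rewrite coefM.
apply: ideal_gen_sum => j _.
by have := ideal_expM (Ip j) (Iq (i - j)%N); rewrite subnKC // -ltnS ltn_ord.
Qed.

HB.instance Definition _ := GRing.isSubringClosed.Build _ rees rees_subring_closed.

Record rees_algebra := ReesElt { rees_val :> {poly A}; _ : rees_val \in rees }.
HB.instance Definition _ := [isSub for rees_val].
HB.instance Definition _ := [Choice of rees_algebra by <:].
HB.instance Definition _ := [SubChoice_isSubComNzRing of rees_algebra by <:].
(* Simplification turns the generic projection of the subtype into [rees_val],
   which therefore has to be known as a morphism too. *)
HB.instance Definition _ :=
  GRing.RMorphism.copy rees_val (val : rees_algebra -> {poly A}).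

(** Multiplying the integral equation of x, of degree m, by T^m gives an equation
for x T with coefficients a_k T^k in the Rees algebra. Conversely, only the
coefficient of T^m matters in a monic equation of degree m for x T. *)
Lemma integral_closureP x :
  integral_closure I x <-> integralOver rees_val (x *: 'X).
Proof.
split=> [[m [a [m_gt0 Ia xm]]]|[p p_mon]].
  pose c k : rees_algebra := insubd 0 (a k *: 'X^k).
  have cE k : (1 <= k <= m)%N -> rees_val (c k) = a k *: 'X^k.
    move=> k_bnd; rewrite -[rees_val _]/(val _) val_insubd ifT //.
    apply/asboolP => i.
    rewrite coefZ coefXn; case: eqP => [->|_]; rewrite ?mulr1 ?mulr0.
      exact: Ia.
    exact: ideal_gen0.
  exists ('X^m + \sum_(1 <= k < m.+1) (c k)%:P * 'X^(m - k)).
    rewrite monicE lead_coefDl ?lead_coefXn // size_polyXn ltnS.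
    rewrite big_nat_cond; apply: (leq_trans (size_sum _ _ _)).
    apply/bigmax_leqP_seq => k _ /andP[/andP[k_gt0 _] _].
    apply: leq_trans (size_polyMleq _ _) _; rewrite size_polyXn size_polyC.
    rewrite addnS /=; have h : (m - k < m)%N by rewrite ltn_subrL k_gt0 m_gt0.
    by case: (c k != 0); rewrite ?add0n // ltnW.
  apply/rootP; rewrite rmorphD /= map_polyXn rmorph_sum /= hornerD hornerXn.
  rewrite horner_sum exprZn big_nat_cond.
  under eq_bigr => k /andP[k_bnd _].
    rewrite rmorphM /= map_polyC map_polyXn /= hornerM hornerC hornerXn cE //.
    rewrite exprZn -scalerAl -scalerAr -exprD subnKC; last by case/andP: k_bnd.
    rewrite scalerA.
    over.
  by rewrite -big_nat_cond -scaler_suml -scalerDl xm scale0r.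
move=> /rootP p0; pose m := (size p).-1.
have sz_p : size p = m.+1 by rewrite /m prednK // size_poly_gt0 monic_neq0.
have pm : p`_m = 1 by move: p_mon; rewrite monicE /lead_coef => /eqP.
have m_gt0 : (0 < m)%N.
  rewrite lt0n; apply/eqP => m0; move: p0.
  have /size_poly1P[c _ pE] : size p == 1%N by rewrite sz_p m0.
  move: pm; rewrite m0 pE coefC eqxx => ->.
  by rewrite map_polyC hornerC => /eqP; rewrite oner_eq0.
exists m, (fun k => (rees_val p`_(m - k))`_k); split=> //.
  by move=> k _; have := valP p`_(m - k) => /asboolP.
(* The a_k just given make the integral equation of x the coefficient of T^m
   in the equation of x T. *)
move/(congr1 (fun q : {poly A} => q`_m)): p0; rewrite coef0 => p0.
rewrite -[RHS]p0.
rewrite (@horner_coef_wide _ m.+1); last first.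
  by rewrite -sz_p size_poly.
rewrite coef_sum.
rewrite -(big_mkord xpredT
  (fun i => ((map_poly rees_val p)`_i * (x *: 'X) ^+ i)`_m)).
rewrite [RHS]big_nat_rev /= [RHS]big_ltn //=.
have E i : (i <= m)%N -> ((map_poly rees_val p)`_(0 + m.+1 - i.+1) *
    (x *: 'X) ^+ (0 + m.+1 - i.+1))`_m = (rees_val p`_(m - i))`_i * x ^+ (m - i).
  move=> le_im; rewrite add0n subSS coef_map /= exprZn -scalerAr coefZ coefMXn.
  by rewrite ltnNge leq_subr /= subKn // mulrC.
rewrite E // subn0 pm rmorph1 coef1 mul1r; congr (_ + _).
by apply: eq_big_nat => i /andP[_ lt_im]; rewrite E.
Qed.

Lemma integral_closureD x y :
  integral_closure I x -> integral_closure I y -> integral_closure I (x + y).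
Proof.
by rewrite !integral_closureP scalerDl; apply: integral_add.
Qed.

Lemma integral_closureM c x : integral_closure I x -> integral_closure I (c * x).
Proof.
case=> m [a [m_gt0 Ia xm]]; exists m, (fun k => c ^+ k * a k); split=> //.
  by move=> k k_bnd; apply/ideal_genM/Ia.
rewrite -[RHS](mulr0 (c ^+ m)) -[in RHS]xm exprMn mulrDr mulr_sumr.
congr (_ + _); apply: eq_big_nat => k.
rewrite ltnS => /andP[_ le_km].
by rewrite exprMn mulrACA -exprD subnKC.
Qed.

Lemma integral_closure0 : integral_closure I 0.
Proof.
by apply: (@integral_of_power _ _ 1) => //; rewrite expr0n; apply: ideal_gen0.
Qed.

End Rees.

(** * Dickson's lemma *)

Lemma nondecreasing_subsequence (h : nat -> nat) :
  exists phi : nat -> nat, {homo phi : i j / (i < j)%N} /\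
    {homo h \o phi : i j / (i <= j)%N}.
Proof.
(* Values attaining the minimum of the tail that they start can be chained. *)
have min_tail N : exists n, (N <= n)%N /\ forall k, (N <= k)%N -> (h n <= h k)%N.
  pose P y := `[< exists2 n, (N <= n)%N & h n = y >].
  have exP : exists y, P y by exists (h N); apply/asboolP; exists N.
  case: (ex_minnP exP) => y /asboolP[n le_Nn <-] min_n.
  exists n; split=> // k le_Nk.
  by apply: min_n; apply/asboolP; exists k.
have [F FP] := choice min_tail.
pose phi := fix phi k := if k is k'.+1 then F (phi k').+1 else F 0%N.
have phi_min k : exists2 N, (N <= phi k)%N &
    forall l, (N <= l)%N -> (h (phi k) <= h l)%N.
  case: k => [|k] /=; first by exists 0%N => //; case: (FP 0%N).
  by exists (phi k).+1; case: (FP (phi k).+1).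
have phiS k : (phi k < phi k.+1)%N by rewrite /=; case: (FP (phi k).+1).
exists phi; split.
  by apply: (@homo_ltn _ _ (fun i j => i < j)%N) => //; apply: ltn_trans.
apply: (@homo_leq _ _ (fun i j => i <= j)%N) => [||k /=] //; first exact: leq_trans.
have [N le_N min_k] := phi_min k.
by apply: min_k; apply: leq_trans le_N (ltnW (phiS k)).
Qed.

(** The product order on functions from a finite set to the naturals has no
infinite bad sequence: pass to a subsequence that is nondecreasing in one
coordinate after the other. *)
Lemma dickson (T : finType) (u : nat -> T -> nat) :
  exists i j, (i < j)%N /\ forall t, (u i t <= u j t)%N.
Proof.
suff [phi [phi_incr phi_u]] : exists phi : nat -> nat,
    {homo phi : i j / (i < j)%N} /\
    forall t, t \in enum T -> {homo (fun n => u (phi n) t) : i j / (i <= j)%N}.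
  exists (phi 0%N), (phi 1%N); split=> [|t]; first exact: phi_incr.
  by apply: phi_u; rewrite ?mem_enum.
elim: (enum T) => [|t ts [phi [phi_incr phi_u]]]; first by exists id; split.
have [psi [psi_incr psi_u]] := nondecreasing_subsequence (fun n => u (phi n) t).
exists (phi \o psi); split=> [i j lt_ij|t']; first exact/phi_incr/psi_incr.
rewrite inE => /predU1P[->|ts_t'] i j le_ij; first exact: psi_u.
by apply: phi_u => //; apply: (ltnW_homo psi_incr).
Qed.

(** * Monomial ideals *)

Section Monomials.
Variables (K : fieldType) (s : nat).
Implicit Types (M : set 'X_{1..s}) (a b m : 'X_{1..s}) (f g : {mpoly K[s]}).

Lemma monomial_ideal_genP M f :
  monomial_ideal_gen M f <->
  forall a, a \in msupp f -> exists2 m, M m & (m <= a)%MM.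
Proof.
split.
  move: f; apply: ideal_gen_min => [a|f g Pf Pg a|c _ [m Mm <-] a].
  - by rewrite msupp0.
  - by move/msuppD_le; rewrite mem_cat => /orP[/Pf|/Pg].
  move/msuppM_le/allpairsP => [[b b'] /= [_]].
  by rewrite msuppX inE => /eqP-> ->; exists m; rewrite ?lem_addl.
move=> Pf; rewrite [f]mpolyE big_seq; apply: ideal_gen_sum => a /Pf[m Mm le_ma].
rewrite -mul_mpolyC -[X in 'X_[X]](submK le_ma) mpolyXD.
by apply/ideal_genM/ideal_genM/ideal_gen_sub; exists m.
Qed.

Lemma monomial_ideal_gen_sub M a :
  M a -> monomial_ideal_gen M ('X_[a] : {mpoly K[s]}).
Proof. by move=> Ma; apply: ideal_gen_sub; exists a. Qed.

Lemma monomial_ideal_genX M a :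
  monomial_ideal_gen M ('X_[a] : {mpoly K[s]}) <-> exists2 m, M m & (m <= a)%MM.
Proof.
rewrite monomial_ideal_genP; split=> [|Ma b]; last first.
  by rewrite msuppX inE => /eqP->.
by apply; rewrite msuppX inE.
Qed.

Lemma msupp_prodP n (x : 'I_n -> {mpoly K[s]}) a :
  a \in msupp (\prod_(i < n) x i) ->
  exists2 b : 'I_n -> 'X_{1..s}, forall i, b i \in msupp (x i)
    & a = (\sum_(i < n) b i)%MM.
Proof.
elim: n x a => [|n IHn] x a.
  rewrite big_ord0 msupp1 inE => /eqP->.
  by exists (fun=> 0%MM) => [[]//|]; rewrite big_ord0.
rewrite big_ord_recl => /msuppM_le/allpairsP[[b0 a'] /= [xb0 /IHn[b xb ->] ->]].
exists (fun i => if unlift ord0 i is Some j then b j else b0) => [i|].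
  by case: unliftP => [j|] ->.
rewrite big_ord_recl unlift_none; congr (_ + _)%MM.
by apply: eq_bigr => i _; rewrite liftK.
Qed.

Lemma lem_sum (J : finType) (b c : J -> 'X_{1..s}) :
  (forall j, (b j <= c j)%MM) -> (\sum_j b j <= \sum_j c j)%MM.
Proof.
move=> le_bc; apply/mnm_lepP => i; rewrite !mnm_sumE.
by apply: leq_sum => j _; apply/mnm_lepP.
Qed.

(** Serves twice: powers of a monomial ideal are monomial ideals with explicit
generators, and, through divisibility of supports, membership in them is a
condition on exponents. *)
Lemma ideal_exp_monomial (T : Type) (w : T -> 'X_{1..s}) n :
  ideal_exp (@monomial_ideal_gen K s (range w)) n =
  monomial_ideal_gen (range (fun u : 'I_n -> T => \sum_j w (u j))%MM).
Proof.
apply/seteqP; split=> [f|].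
  rewrite /ideal_exp; move: f.
  apply: ideal_gen_min => [||c _ [x [Ix ->]]]; first exact: ideal_gen0.
    exact: ideal_genD.
  apply: ideal_genM; apply/monomial_ideal_genP => _ /msupp_prodP[b xb ->].
  have /choice[u uP] j : exists t, (w t <= b j)%MM.
    by move/monomial_ideal_genP: (Ix j) => /(_ _ (xb j)) [_ [t _ <-]]; exists t.
  by exists (\sum_j w (u j))%MM; [exists u | apply: lem_sum].
apply: ideal_gen_min => [||c _ [_ [u _ <-] <-]]; first exact: ideal_gen0.
  exact: ideal_genD.
apply/ideal_genM/ideal_gen_sub; exists (fun j => 'X_[w (u j)]); split.
  by move=> j; apply: monomial_ideal_gen_sub; exists (u j).
by rewrite mprodXE.
Qed.

(** * Integral closure of a monomial ideal *)

(** The hypothesis says that f is almost integral over I. Comparing two of its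
instances, chosen by Dickson's lemma, makes the denominator c disappear. *)
Lemma lead_power_of_almost_integral (T : finType) (w : T -> 'X_{1..s})
    (I := @monomial_ideal_gen K s (range w)) c f :
  c != 0 -> f != 0 -> (forall n, ideal_exp I n (c * f ^+ n)) ->
  exists2 k, (0 < k)%N & ideal_exp I k ('X_[mlead f] ^+ k).
Proof.
move=> c_neq0 f_neq0 almost_f.
have u_ex n : exists u : 'I_n -> T,
    (\sum_j w (u j) <= mlead c + mlead f *+ n)%MM.
  have := almost_f n; rewrite ideal_exp_monomial => /monomial_ideal_genP.
  have fn_neq0 : f ^+ n != 0 by rewrite expf_neq0.
  case/(_ (mlead c + mlead f *+ n)%MM) => [|_ [g _ <-] le_g]; last by exists g.
  by rewrite -mleadX // -mleadM // mlead_supp // mulf_neq0.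
pose u n := projT1 (cid (u_ex n)).
have uP n : (\sum_j w (u n j) <= mlead c + mlead f *+ n)%MM :=
  projT2 (cid (u_ex n)).
pose count n t := #|[pred j | u n j == t]|.
have count_sum n : (\sum_t count n t = n)%N.
  rewrite -[RHS]card_ord -sum1_card (partition_big (u n) xpredT) //=.
  by apply: eq_bigr => t _; rewrite /count -sum1_card.
have w_sum n : (\sum_j w (u n j) = \sum_t w t *+ count n t)%MM.
  rewrite (partition_big (u n) xpredT) //=; apply: eq_bigr => t _.
  rewrite (eq_bigr (fun=> w t)) => [|j /eqP->//].
  by apply/mnmP => i; rewrite mnm_sumE sum_nat_const mulmnE mulnC.
(* Dickson's lemma is applied jointly to the multiplicity of each generator
   and to the exponents of the remaining monomial cofactor. *)
pose rest n i := (mlead c + mlead f *+ n - \sum_j w (u n j))%MM i.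
have [i [j [lt_ij le_ij]]] := dickson (fun n (x : T + 'I_s) =>
  match x with inl t => count n t | inr l => rest n l end).
exists (j - i)%N; first by rewrite subn_gt0.
pose d t := (count j t - count i t)%N.
have d_sum : (\sum_t d t = j - i)%N.
  rewrite /d sumnB ?count_sum // => t _; exact: (le_ij (inl t)).
have wd_le : (\sum_t w t *+ d t <= mlead f *+ (j - i))%MM.
  apply/mnm_lepP => l; rewrite mnm_sumE mulmnE.
  under eq_bigr => t _ do rewrite mulmnE mulnBr.
  rewrite sumnB; last by move=> t _; rewrite leq_mul2l (le_ij (inl t)) orbT.
  have sumE n : (\sum_t w t l * count n t = (\sum_j w (u n j))%MM l)%N.
    by rewrite w_sum mnm_sumE; apply: eq_bigr => t _; rewrite mulmnE.
  rewrite !sumE; have := le_ij (inr l); rewrite /rest !mnmBE !mnmDE !mulmnE.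
  have /mnm_lepP/(_ l) := uP i; have /mnm_lepP/(_ l) := uP j.
  rewrite !mnmDE !mulmnE mulnBr; have := leq_mul (leqnn (mlead f l)) (ltnW lt_ij).
  by move: (_ * j)%N (_ * i)%N => fj fi; lia.
rewrite mpolyXn -(submK wd_le) mpolyXD -d_sum; apply: ideal_genM.
rewrite -mprodXnE.
apply: ideal_exp_prodX => t; apply: monomial_ideal_gen_sub.
by exists t.
Qed.

(** The leading term of f is integral, hence so is f minus that term: the sum of
integral elements is integral. *)
Lemma integral_closure_support (T : finType) (t0 : T) (w : T -> 'X_{1..s})
    (I := @monomial_ideal_gen K s (range w)) f :
  integral_closure I f -> forall a, a \in msupp f ->
  exists2 k, (0 < k)%N & ideal_exp I k ('X_[a] ^+ k).
Proof.
have [n] := ubnP (size (msupp f)); elim: n f => // n IHn f lt_f int_f.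
have [->|f_neq0] := eqVneq f 0; first by move=> a; rewrite msupp0.
have lead_pow : exists2 k, (0 < k)%N & ideal_exp I k ('X_[mlead f] ^+ k).
  have [m almost_f] := integral_almost int_f.
  apply: (@lead_power_of_almost_integral _ w ('X_[w t0] ^+ m)) => //.
    by rewrite mpolyXn -msupp_eq0 msuppX.
  apply/almost_f/ideal_expX/monomial_ideal_gen_sub.
  by exists t0.
pose f' := f - f@_(mlead f) *: 'X_[mlead f].
have supp_f' : perm_eq (msupp f') (rem (mlead f) (msupp f)) by exact: msupp_rem.
have int_f' : integral_closure I f'.
  apply: integral_closureD => //; rewrite -scaleNr -mul_mpolyC.
  apply: integral_closureM; case: lead_pow => k k_gt0.
  exact: integral_of_power.
move=> a; have [->//|a_neq] := eqVneq a (mlead f) => fa.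
apply: (IHn f') => //.
  rewrite (perm_size supp_f') size_rem ?mlead_supp //.
  by rewrite -ltnS prednK // lt0n size_eq0 msupp_eq0.
by rewrite (perm_mem supp_f') mem_rem_uniq ?msupp_uniq // inE a_neq.
Qed.

Lemma integral_closure_monomial (T : finType) (t0 : T) (w : T -> 'X_{1..s})
    (I := @monomial_ideal_gen K s (range w)) :
  integral_closure I = monomial_ideal_gen
    [set a | exists2 k, (0 < k)%N & ideal_exp I k ('X_[a] ^+ k)].
Proof.
apply/seteqP; split=> [f int_f|].
  apply/monomial_ideal_genP => a /(integral_closure_support t0 int_f) pow_a.
  by exists a; rewrite ?lepm_refl.
apply: ideal_gen_min => [|x y|c _ [a [k k_gt0 pow_a] <-]].
- exact: integral_closure0.
- exact: integral_closureD.
by apply: integral_closureM; apply: integral_of_power pow_a.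
Qed.

(** * Initial degrees *)

(** The exponents that are minimal in M for divisibility form the minimal
monomial generators, and an exponent of least degree is among them. *)
Lemma initial_degree_eq M e :
  (exists2 a, M a & mdeg a = e) -> (forall a, M a -> (e <= mdeg a)%N) ->
  initial_degree (@monomial_ideal_gen K s M) = e.
Proof.
move=> [a0 Ma0 a0_deg] M_deg; set L := monomial_ideal_gen M.
have L_deg M' b : minimal_monomial_generators L M' -> M' b -> (e <= mdeg b)%N.
  move=> [LE _] M'b.
  have : L 'X_[b] by rewrite LE; apply: monomial_ideal_gen_sub.
  case/monomial_ideal_genX => m /M_deg le_m /lem_leo/lemc_mdeg.
  exact: leq_trans.
pose M0 := [set a | M a /\ forall b, M b -> (b <= a)%MM -> b = a].
(* Descent on the degree. *)
have M0_below a : M a -> exists2 b, M0 b & (b <= a)%MM.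
  have [n] := ubnP (mdeg a); elim: n a => // n IHn a lt_a Ma.
  have [min_a|] := pselect (forall b, M b -> (b <= a)%MM -> b = a).
    by exists a; rewrite ?lepm_refl.
  case/existsNP => b /not_implyP[Mb /not_implyP[le_ba neq_ba]].
  have lt_ba : (mdeg b < mdeg a)%N.
    rewrite -(submK le_ba) mdegD -[X in (X < _)%N]add0n ltn_add2r lt0n mdeg_eq0.
    apply/eqP => ab0; apply: neq_ba.
    by rewrite -[RHS](submK le_ba) ab0 add0m.
  have [c M0c le_cb] := IHn b (leq_trans lt_ba lt_a) Mb.
  by exists c => //; apply: lepm_trans le_ba.
have M0_gen : minimal_monomial_generators L M0.
  split.
    apply/seteqP; split=> f /monomial_ideal_genP f_gen;
      apply/monomial_ideal_genP => a /f_gen[m].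
      move=> /M0_below[b M0b le_bm] le_ma; exists b => //.
      exact: lepm_trans le_ma.
    by case=> Mm _ le_ma; exists m.
  move=> M' sub_M' LE; apply/seteqP; split=> // a [Ma min_a].
  have : L 'X_[a] by apply: monomial_ideal_gen_sub.
  rewrite LE => /monomial_ideal_genX[m M'm le_ma].
  by have [Mm _] := sub_M' _ M'm; rewrite -(min_a m).
have M0a0 : M0 a0.
  split=> // b Mb le_ba; move: (M_deg b Mb).
  rewrite -a0_deg -{1}(submK le_ba) mdegD -[leqRHS]add0n leq_add2r leqn0 mdeg_eq0.
  by move=> /eqP ab0; rewrite -[RHS](submK le_ba) ab0 add0m.
rewrite /initial_degree; case: xgetP => [k -> [[a [gen_a <-]] min_a]|].
  apply/eqP; rewrite eqn_leq -{1}a0_deg min_a /=; last by exists M0.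
  by case: gen_a => M' [M'_gen M'a]; apply: L_deg M'a.
move/(_ e); case; split; first by exists a0; split=> //; exists M0.
by move=> b [M' [M'_gen M'b]]; apply: L_deg M'b.
Qed.

(** Passing to the integral closure adds no monomial of smaller degree: t^(k a)
in I^k forces k e <= k |a|. *)
Lemma initial_degree_closure_equigenerated (T : finType) (t0 : T)
    (w : T -> 'X_{1..s}) e :
  (forall t, mdeg (w t) = e) ->
  initial_degree (integral_closure (@monomial_ideal_gen K s (range w))) = e.
Proof.
move=> w_deg; rewrite (integral_closure_monomial t0); apply: initial_degree_eq.
  exists (w t0) => //; exists 1%N => //.
  by apply/ideal_exp1/monomial_ideal_gen_sub; exists t0.
move=> a [k k_gt0]; rewrite mpolyXn ideal_exp_monomial.
case/monomial_ideal_genX => _ [u _ <-] /lem_leo/lemc_mdeg.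
rewrite mdegMn mdeg_sum (eq_bigr (fun=> e)) // sum_nat_const card_ord mulnC.
by rewrite leq_pmul2r.
Qed.

End Monomials.

(** The integral closure of I^n has initial degree n d, so that the quotient is
constant for n > 0. *)
Lemma initial_degree_closure_power (K : fieldType) (s n d : nat) (T : finType)
    (t0 : T) (v : T -> 'X_{1..s}) :
  (forall t, mdeg (v t) = d) ->
  initial_degree (integral_closure
    (ideal_exp (@monomial_ideal_gen K s (range v)) n)) = (n * d)%N.
Proof.
move=> v_deg; rewrite ideal_exp_monomial.
(* Finite functions make the index set of the generators of I^n a finite type. *)
have -> : range (fun u : 'I_n -> T => \sum_j v (u j))%MM =
          range (fun u : {ffun 'I_n -> T} => \sum_j v (u j))%MM.
  apply/seteqP; split=> _ [u _ <-]; last by exists u.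
  by exists [ffun j => u j] => //; apply: eq_bigr => j _; rewrite ffunE.
apply: (initial_degree_closure_equigenerated _ [ffun=> t0]) => u.
by rewrite mdeg_sum (eq_bigr (fun=> d)) // sum_nat_const card_ord.
Qed.

(* The q >= 1 generators t^(v_1), ..., t^(v_q) are indexed by 'I_q'.+1 with
   q = q'.+1, so that v_q is v ord_max. *)
Theorem corollary3p7 (R : realType) (K : fieldType) (s q' d : nat)
    (I : set {mpoly K[s]}) (v : 'I_q'.+1 -> 'X_{1..s})
    (v_inj : injective v)
    (v_deg : forall i, mdeg (v i) = d)
    (I_gen : minimal_monomial_generators I (range v))
    (I_complete : complete_ideal I) :
  (fun n : nat =>
     (initial_degree (integral_closure (ideal_exp I n)))%:R / n%:R : R)
    @ \oo --> ((mdeg (v ord_max))%:R : R).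
Proof.
case: I_gen => -> _; rewrite v_deg; apply: cvg_near_cst.
near=> n; rewrite (initial_degree_closure_power _ _ ord_max v_deg).
rewrite natrM mulrC mulKf // pnatr_eq0 -lt0n.
by near: n; exists 1%N.
Unshelve. all: by end_near. Qed.
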